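(* There exists a universal constant $\kappa\ge1$ such that the following holds. Let $n\ge2$, $1\le k\le n/2$, let $f\colon\{0,1\}^m\to\{0,1\}^n$ be a $d$-local function, define $\gamma=k/n$, and let $\theta>0$ be arbitrary (possibly depending on $n$). If $\theta\ge\kappa$, $$d\le\log^*(\theta)/60\quad\text{and}\quad\log^*(1/\gamma)\le\log^*(\theta)/2,$$ then $$\|f(\mathcal{U}^m)-\mathcal{D}_k\|\ge 1-\theta/\sqrt n.$$
   Context: $\mathcal{U}^m$ is uniform on $\{0,1\}^m$; $\mathcal{D}_k$ is the uniform distribution on strings in $\{0,1\}^n$ of Hamming weight $k$. A function $f$ is $d$-local if each output bit depends on at most $d$ input bits. $\log^*$ is the iterated base-2 logarithm: $\log^*(x)$ is the least $h\ge0$ with $\mathrm{tow}_2(h)\ge x$, where $\mathrm{tow}_2(0)=1$ and $\mathrm{tow}_2(h)=2^{\mathrm{tow}_2(h-1)}$. $\|\cdot\|$ is total variation distance. *)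

(* Defs.v *)
From HB Require Import structures.
From mathcomp Require Import all_boot all_order all_algebra.
From mathcomp Require Import reals.
Set Implicit Arguments. Unset Strict Implicit. Unset Printing Implicit Defensive.
Import Order.TTheory GRing.Theory Num.Theory.
Local Open Scope ring_scope.

Fixpoint tow2 (h : nat) : nat := if h is h'.+1 then (2 ^ tow2 h')%N else 1%N.

Lemma tow2_ge (h : nat) : (h <= tow2 h)%N.
Proof.
elim: h => [//|h IH] /=.
exact: leq_ltn_trans IH (ltn_expl _ (isT : (1 < 2)%N)).
Qed.

Lemma logstar_ex (R : realType) (x : R) : exists h : nat, x <= (tow2 h)%:R.
Proof.
have [x0|x0] := lerP x 0.
  by exists 0%N; apply: le_trans x0 _.
exists (Num.bound x).
apply: le_trans (ltW (archi_boundP (ltW x0))) _.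
by rewrite ler_nat tow2_ge.
Qed.

Definition logstar (R : realType) (x : R) : nat := ex_minn (logstar_ex x).

Definition weight (n : nat) (y : {ffun 'I_n -> bool}) : nat := #|[set i | y i]|.

Definition local (m n d : nat) (f : {ffun 'I_m -> bool} -> {ffun 'I_n -> bool}) : Prop :=
  forall j : 'I_n, exists S : {set 'I_m}, (#|S| <= d)%N /\
    forall x y : {ffun 'I_m -> bool}, (forall i, i \in S -> x i = y i) -> f x j = f y j.

Definition push_unif (R : realType) (m n : nat)
  (f : {ffun 'I_m -> bool} -> {ffun 'I_n -> bool}) (y : {ffun 'I_n -> bool}) : R :=
  #|[set x | f x == y]|%:R / (2 ^ m)%:R.

Definition Dk (R : realType) (n k : nat) (y : {ffun 'I_n -> bool}) : R :=
  (weight y == k)%:R / ('C(n, k))%:R.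

Definition tvd (R : realType) (T : finType) (p q : T -> R) : R :=
  2^-1 * \sum_(y : T) `|p y - q y|.

(* Main.v *)
(* Group the inputs by degree into d + 1 layers between tower-spaced thresholds;
   each output misses a layer, so a fraction 1/(d+1) of the outputs miss the same
   one.  Call S the few inputs above it.  Once S is fixed, these outputs have
   bounded neighbourhoods, and a greedy choice gives a set J of outputs v whose
   neighbourhoods nbhd v are pairwise disjoint.  Given the inputs in S, say that v
   is hit by y if y v = 0 (when f v is always 1) or if y is 1 on nbhd v (otherwise).
   Under D_k, compared with a Bernoulli(k/n) product, few hits are so unlikely that
   a union bound over the assignments of S is affordable.  Under f(U), a hit v can
   be switched to 0 by changing inputs seen only by nbhd v, which lowers the weight;
   random independent switches then make the weight anticoncentrated, by the
   Littlewood-Offord inequality.  The event "weight k and many hits" separates the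
   two distributions. *)
Require Import Defs.
From mathcomp Require Import all_boot all_order all_algebra.
From mathcomp Require Import reals.
From mathcomp Require Import zify ring lra.
Import Order.TTheory GRing.Theory Num.Theory.
Set Implicit Arguments.
Unset Strict Implicit.
Unset Printing Implicit Defensive.
Local Open Scope ring_scope.

(** * A Littlewood-Offord inequality *)

(* The binomial coefficients of order l in decreasing order: [midbin l 1] is
   the largest, and [midbin l 0 = midbin l 1] makes Pascal's rule uniform. *)
Definition midbin (l r : nat) : nat := 'C(l, (l + r)./2).

Definition sum_midbin (l r : nat) : nat := (\sum_(i < r) midbin l i.+1)%N.

(** Pascal's rule; the two indices on the right mirror the two sums, with and without a new element,
    in the induction of [littlewood_offord_gen]. *)
Lemma midbinS (l r : nat) :
  midbin l.+1 r.+1 = (midbin l r.+2 + midbin l r)%N.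
Proof. by rewrite /midbin addSnnS !addnS /= binS. Qed.

Lemma midbin0 (l : nat) : midbin l 0 = midbin l 1.
Proof.
rewrite /midbin addn0 addn1 -bin_sub; last by lia.
by congr 'C(_, _); lia.
Qed.

Lemma leq_midbinS (l r : nat) : (midbin l r.+1 <= midbin l r)%N.
Proof.
elim: l r => [|l IH] [|r]; rewrite ?midbin0 //.
by rewrite !midbinS leq_add.
Qed.

Lemma leq_midbin (l r s : nat) : (r <= s)%N -> (midbin l s <= midbin l r)%N.
Proof.
move=> rs; rewrite -(subnKC rs); elim: (s - r)%N => [|j IH]; first by rewrite addn0.
by rewrite addnS; apply: leq_trans (leq_midbinS _ _) IH.
Qed.

Lemma sum_midbinS (l r : nat) :
  sum_midbin l.+1 r.+1 = (sum_midbin l r.+2 + sum_midbin l r)%N.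
Proof.
rewrite /sum_midbin; under eq_bigr do rewrite midbinS.
rewrite big_split /= [X in _ = (X + _)%N]big_ord_recl /= -midbin0.
by rewrite [X in (_ + X)%N = _]big_ord_recl /= addnCA addnA.
Qed.

Lemma sum_midbinD (l x j : nat) :
  sum_midbin l (x + j) = (sum_midbin l x + \sum_(i < j) midbin l (x + i).+1)%N.
Proof. by rewrite /sum_midbin big_split_ord. Qed.

(** Both sides count equally many terms. After cancellation, [j] terms starting at index [s + j + 3]
    are compared with [j] terms starting at index [s + 1], and [midbin l] decreases. *)
Lemma sum_midbin_concave (l s j : nat) :
  (sum_midbin l (s + j + j.+2) + sum_midbin l s <=
   sum_midbin l (s + j).+2 + sum_midbin l (s + j))%N.
Proof.
rewrite addnS addnS -addSn -addSn (sum_midbinD _ (s + j).+2) (sum_midbinD _ s).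
rewrite -addnA leq_add2l addnC leq_add2l.
by apply: leq_sum => i _; apply: leq_midbin; lia.
Qed.

(** Consecutive central coefficients have ratio 2(2j + 1)/(j + 1), so the induction step reduces to
    (2j + 1)(2j + 3) <= 4(j + 1)^2. *)
Lemma central_bin_sqr (j : nat) : ('C(j.*2, j) ^ 2 * j.*2.+1 <= 4 ^ j.*2)%N.
Proof.
elim: j => [//|j IH].
have E : ('C(j.+1.*2, j.+1) * j.+1 = 'C(j.*2, j) * (2 * j.*2.+1))%N.
  have e1 := mul_bin_diag j.*2.+2 j; have e2 := mul_bin_down j.*2.+1 j.
  have e3 : (j.*2.+1 - j = j.+1)%N by lia.
  rewrite /= e3 in e1 e2; rewrite doubleS mulnC -e1 -doubleS -muln2 -mulnA.
  by rewrite mulnCA -e2; lia.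
rewrite -(leq_pmul2r (_ : 0 < j.+1 ^ 2)%N) ?expn_gt0 //.
rewrite mulnAC -expnMn E.
rewrite expnMn doubleS [(4 ^ _.+2)%N]expnS [(4 ^ _.+1)%N]expnS; move: IH.
set C := 'C(_, _); set q := (4 ^ _)%N => IH.
have H : ((2 * j.*2.+1) ^ 2 * j.*2.+3 <= j.*2.+1 * (16 * j.+1 ^ 2))%N.
  by rewrite -[(_ ^ 2)%N]mulnn -[(j.+1 ^ 2)%N]mulnn; nia.
have := leq_mul IH (leqnn (16 * j.+1 ^ 2)%N); have := leq_mul (leqnn (C ^ 2)%N) H.
by rewrite -!mulnn; lia.
Qed.

Lemma midbin1_sqr (l : nat) : (midbin l 1 ^ 2 * l.+1 <= 4 ^ l)%N.
Proof.
rewrite -[l]odd_double_half; case: (odd l); last first.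
  by rewrite add0n -midbin0 /midbin addn0 doubleK central_bin_sqr.
(* For odd order, the largest coefficient is half of the next central one. *)
move: l./2 => {l} j; rewrite add1n.
have := central_bin_sqr j.+1; rewrite doubleS binS.
have -> : 'C(j.*2.+1, j.+1) = midbin j.*2.+1 1 by congr 'C(_, _); lia.
have -> : 'C(j.*2.+1, j) = midbin j.*2.+1 1.
  by rewrite -midbin0; congr 'C(_, _); lia.
by rewrite [(4 ^ _.+2)%N]expnS -!mulnn; set q := (4 ^ _)%N; lia.
Qed.

Lemma sum_undup_filter (f : int -> nat) (X Y : seq int) : uniq X -> uniq Y ->
  (\sum_(a <- X) f a + \sum_(a <- Y) f a =
   \sum_(a <- undup (X ++ Y)) f a + \sum_(a <- [seq a <- X | a \in Y]) f a)%N.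
Proof.
move=> uX uY.
have -> : (\sum_(a <- undup (X ++ Y)) f a =
           \sum_(a <- [seq a <- X | a \notin Y]) f a + \sum_(a <- Y) f a)%N.
  rewrite -big_cat /=; apply: perm_big; by rewrite undup_cat !undup_id.
rewrite addnAC; congr addn; rewrite !big_filter addnC.
by rewrite [LHS](bigID (fun a => a \in Y)).
Qed.

Lemma sum_mem_count (K : finType) (A : {set {set K}}) (g : {set K} -> int)
    (X : seq int) : uniq X ->
  (\sum_(a <- X) #|[set T in A | g T == a]| = #|[set T in A | g T \in X]|)%N.
Proof.
elim: X => [_|a X IH /= /andP[aX uX]].
  by rewrite big_nil; apply/esym/eqP; rewrite cards_eq0;
    apply/eqP/setP=> T; rewrite !inE andbF.
rewrite big_cons IH // -cardsUI.
rewrite [X in (_ + X)%N](_ : _ = 0)%N ?addn0; last first.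
  apply/eqP; rewrite cards_eq0; apply/eqP/setP => T; rewrite !inE.
  by case: (eqVneq (g T) a) => [->|]; rewrite ?(negbTE aX) !andbF.
by apply: eq_card => T; rewrite !inE; case: (T \in A).
Qed.

(** A nonempty finite set of integers is not invariant under a nonzero translation, since its sum
    would change by [c] times its size. *)
Lemma sum_shift_neq (X : seq int) (c : int) : c != 0 -> X != [::] -> uniq X ->
  (size [seq a <- X | a \in [seq (b - c)%R | b <- X]] < size X)%N.
Proof.
move=> c0 X0 uX; rewrite ltn_neqAle size_filter count_size andbT.
apply/negP; rewrite -all_count => /allP sub.
have uY : uniq [seq b - c | b <- X] by rewrite map_inj_uniq // => a b /addIr.
have [|_ eqXY] := uniq_min_size uX sub; first by rewrite size_map.
have E : perm_eq X [seq b - c | b <- X] by apply: uniq_perm.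
have : \sum_(a <- X) a = \sum_(a <- [seq b - c | b <- X]) a by apply: perm_big.
rewrite big_map sumrB -[LHS]addr0 => /addrI/esym/eqP.
rewrite oppr_eq0 big_const_seq count_predT iter_addr_0 mulrn_eq0 (negbTE c0) orbF.
by case: X X0 {uX sub uY eqXY E}.
Qed.

(** Allowing a set [X] of target values makes induction on [J] possible: removing [v] leaves the
    targets [X] (subsets without [v]) and [X] translated by [- c v] (subsets with [v]). *)
Lemma littlewood_offord_gen (K : finType) (c : K -> int) (J : {set K}) (X : seq int) :
  uniq X ->
  (#|[set T in powerset J | (\sum_(v in T) c v)%R \in X]| <=
   2 ^ #|[set v in J | (c v == 0)%R]| *
     sum_midbin #|[set v in J | (c v != 0)%R]| (size X))%N.
Proof.
elim: {J}#|J| {-2}J (erefl #|J|) X => [|j IH] J.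
  move/eqP; rewrite cards_eq0 => /eqP-> X uX.
  rewrite [X in (2 ^ X)%N]eq_card0 ?[X in sum_midbin X]eq_card0; last first.
  - by move=> v; rewrite !inE.
  - by move=> v; rewrite !inE.
  case: X uX => [|a X] uX.
    by rewrite [X in (X <= _)%N]eq_card0 // => T; rewrite !inE andbF.
  rewrite expn0 mul1n /sum_midbin big_ord_recl.
  apply: (@leq_trans 1); last by rewrite -[1%N]/(midbin 0 1) leq_addr.
  rewrite -[1%N](cards1 (set0 : {set K})) subset_leq_card //.
  by apply/subsetP => T; rewrite powerset0 !inE => /andP[].
move=> cJ; have /card_gt0P[v vJ] : (0 < #|J|)%N by rewrite cJ.
have cJv : j = #|J :\ v| by move: cJ; rewrite (cardsD1 v) vJ => -[].
have split_count a : (#|[set T in powerset J | (\sum_(u in T) c u)%R == a]| =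
    #|[set T in powerset (J :\ v) | (\sum_(u in T) c u)%R == a]| +
    #|[set T in powerset (J :\ v) | (\sum_(u in T) c u)%R == (a - c v)%R]|)%N.
  rewrite -(cardsID [set T : {set K} | v \notin T]); congr addn.
    by apply: eq_card => T; rewrite !inE subsetD1 andbAC.
  rewrite -[RHS](card_in_imset (f := fun T => v |: T)); last first.
    move=> T1 T2; rewrite !inE !subsetD1 => /andP[/andP[_ v1] _] /andP[/andP[_ v2] _] E.
    by rewrite -(setU1K v1) -(setU1K v2) E.
  apply: eq_card => T; rewrite !inE negbK; apply/idP/imsetP.
    move=> /and3P[vT TJ /eqP S]; exists (T :\ v); last by rewrite setD1K.
    rewrite !inE setSD //=; move: S; rewrite (big_setD1 v) //= => <-.
    by rewrite addrAC subrr add0r.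
  case=> T'; rewrite !inE subsetD1 => /andP[/andP[T'J vT'] /eqP S] ->.
  rewrite setU11 subUset sub1set vJ T'J big_setU1 //= S.
  by rewrite addrC subrK.
move=> X uX.
rewrite -sum_mem_count //; under eq_bigr do rewrite split_count.
rewrite big_split /=.
have shiftE : (\sum_(a <- X)
    #|[set T in powerset (J :\ v) | (\sum_(u in T) c u)%R == (a - c v)%R]| =
  \sum_(a <- [seq (b - c v)%R | b <- X])
    #|[set T in powerset (J :\ v) | (\sum_(u in T) c u)%R == a]|)%N.
  by rewrite big_map.
rewrite {}shiftE.
have [cv0|cv0] := eqVneq (c v) 0.
  have -> : [seq b - c v | b <- X] = X.
    by rewrite -[RHS]map_id; apply: eq_map => b; rewrite cv0 subr0.
  rewrite !sum_mem_count // addnn -mul2n.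
  have -> : #|[set u in J | (c u == 0)%R]| = #|[set u in J :\ v | (c u == 0)%R]|.+1.
    rewrite (cardsD1 v) !inE vJ cv0 eqxx add1n; congr S; apply: eq_card => u.
    by rewrite !inE andbA.
  have -> : #|[set u in J | (c u != 0)%R]| = #|[set u in J :\ v | (c u != 0)%R]|.
    apply: eq_card => u; rewrite !inE.
    by case: (eqVneq u v) => [->|//]; rewrite cv0 eqxx andbF.
  by rewrite expnS -mulnA leq_mul2l /=; apply: IH.
have -> : #|[set u in J | (c u != 0)%R]| = #|[set u in J :\ v | (c u != 0)%R]|.+1.
  rewrite (cardsD1 v) !inE vJ cv0 add1n; congr S; apply: eq_card => u.
  by rewrite !inE andbA.
have -> : #|[set u in J | (c u == 0)%R]| = #|[set u in J :\ v | (c u == 0)%R]|.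
  apply: eq_card => u; rewrite !inE.
  by case: (eqVneq u v) => [->|//]; rewrite (negbTE cv0) andbF.
have [->|X0] := eqVneq X [::]; first by rewrite !big_nil.
have uY : uniq [seq b - c v | b <- X] by rewrite map_inj_uniq // => a b /addIr.
(* [X] and its translate are traded for their union [U] and intersection [F], which preserves the
   total count. As [F] is strictly smaller than [X], Pascal's rule and concavity close the
   induction. *)
have := sum_undup_filter (fun=> 1%N) uX uY; rewrite !sum1_size size_map.
have := sum_shift_neq cv0 X0 uX.
rewrite sum_undup_filter // !sum_mem_count ?undup_uniq ?filter_uniq //.
set U := undup _; set F := [seq a <- X | _] => ltF szU.
have bU := IH _ (esym cJv) U (undup_uniq _).
have bF := IH _ (esym cJv) F (filter_uniq _ uX).
apply: leq_trans (leq_add bU bF) _; rewrite -mulnDr leq_mul2l; apply/orP; right.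
have {}ltF : (size F < size X)%N := ltF.
have {}szU : (size X + size X = size U + size F)%N := szU.
have [i Ei] : exists i, size X = (size F + i).+1.
  by exists (size X - size F).-1; move: ltF; set p := size X; set q := size F; lia.
have -> : size U = (size F + i + i.+2)%N.
  by move: szU; rewrite Ei; set p := size U; set q := size F; lia.
by rewrite Ei sum_midbinS sum_midbin_concave.
Qed.

(** The case of one target, squared to stay within the natural numbers: a uniformly random subset
    sum takes a given value with probability at most 1/sqrt(l + 1), where l counts the nonzero
    coefficients. *)
Lemma littlewood_offord (K : finType) (c : K -> int) (J : {set K}) (a : int) :
  (#|[set T in powerset J | (\sum_(v in T) c v)%R == a]| ^ 2 *
     #|[set v in J | (c v != 0)%R]|.+1 <= 4 ^ #|J|)%N.
Proof.
have := @littlewood_offord_gen K c J [:: a] isT.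
rewrite /sum_midbin big_ord1; set z := #|[set v in J | (c v == 0)%R]|.
set l := #|[set v in J | (c v != 0)%R]|.
have -> : #|J| = (z + l)%N.
  rewrite -(cardsID [set v | (c v == 0)%R]) /z /l; congr addn; apply: eq_card => v.
    by rewrite !inE.
  by rewrite !inE andbC.
have -> : [set T in powerset J | (\sum_(v in T) c v)%R \in [:: a]] =
          [set T in powerset J | (\sum_(v in T) c v)%R == a].
  by apply/setP => T; rewrite !inE.
move=> bd; rewrite expnD; have := midbin1_sqr l.
have -> : (4 ^ z = (2 ^ z) ^ 2)%N by rewrite -expnM mulnC expnM.
move=> bl; apply: leq_trans (leq_mul (_ : _ <= (2 ^ z * midbin l 1) ^ 2)%N (leqnn _)) _.
  by rewrite leq_exp2r.
by rewrite expnMn -mulnA leq_mul2l bl orbT.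
Qed.

(** * Bernoulli product measures *)

Section Bernoulli.

Variables (R : realFieldType) (I : finType) (p : R).
Hypothesis p01 : 0 <= p <= 1.

Implicit Types (x y : {ffun I -> bool}) (A B : {set I}).

Definition bern1 (b : bool) : R := if b then p else 1 - p.

Definition bern x : R := \prod_i bern1 (x i).

Definition expect (F : {ffun I -> bool} -> R) : R := \sum_x bern x * F x.

Definition depends_on (U : Type) A (F : {ffun I -> bool} -> U) : Prop :=
  forall x y, (forall i, i \in A -> x i = y i) -> F x = F y.

Definition mix A x y : {ffun I -> bool} := [ffun i => if i \in A then x i else y i].

Lemma bern1_ge0 b : 0 <= bern1 b.
Proof. by have /andP[p0 p1] := p01; case: b => /=; lra. Qed.

Lemma bern_ge0 x : 0 <= bern x.
Proof. by apply: prodr_ge0 => i _; apply: bern1_ge0. Qed.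

Lemma expect_prod (F : I -> bool -> R) :
  expect (fun x => \prod_i F i (x i)) = \prod_i (p * F i true + (1 - p) * F i false).
Proof.
rewrite /expect; have E x : bern x * \prod_i F i (x i) = \prod_i (bern1 (x i) * F i (x i)).
  by rewrite big_split.
rewrite (eq_bigr _ (fun x _ => E x)).
by rewrite -(bigA_distr_bigA (fun i b => bern1 b * F i b)); apply: eq_bigr => i _; rewrite big_bool.
Qed.

Lemma expect_cst c : expect (fun=> c) = c.
Proof.
have total : expect (fun=> \prod_(i : I) 1) = 1.
  by rewrite (expect_prod (fun _ _ => 1)) big1 // => i _; ring.
transitivity (expect (fun=> \prod_(i : I) 1) * c); last by rewrite total mul1r.
by rewrite /expect [RHS]mulr_suml; apply: eq_bigr => x _; rewrite big1_eq mulr1.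
Qed.

Lemma ler_expect F G : (forall x, F x <= G x) -> expect F <= expect G.
Proof. by move=> FG; apply: ler_sum => x _; rewrite ler_wpM2l ?bern_ge0. Qed.

Lemma eq_expect F G : F =1 G -> expect F = expect G.
Proof. by move=> FG; apply: eq_bigr => x _; rewrite FG. Qed.

Lemma expectD F G : expect (fun x => F x + G x) = expect F + expect G.
Proof. by rewrite -big_split; apply: eq_bigr => x _; rewrite mulrDr. Qed.

Lemma expectZ c F : expect (fun x => c * F x) = c * expect F.
Proof. by rewrite mulr_sumr; apply: eq_bigr => x _; rewrite mulrCA. Qed.

(* Resampling the coordinates in [A] from an independent copy is a measure
   preserving involution of pairs, which decouples [F] from [G]. *)
Lemma expect_indep A F G : depends_on A F -> depends_on (~: A) G ->
  expect (fun x => F x * G x) = expect F * expect G.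
Proof.
move=> dF dG; pose sw (z : _ * _) := (mix A z.1 z.2, mix A z.2 z.1).
have swK : involutive sw.
  by case=> x y; congr pair; apply/ffunP => i; rewrite /= !ffunE; case: (i \in A).
have -> : expect F * expect G =
    \sum_(z : _ * _) bern z.1 * bern z.2 * (F z.1 * G z.2).
  rewrite -(pair_bigA _ (fun x y => bern x * bern y * (F x * G y))) /= mulr_suml.
  apply: eq_bigr => x _; rewrite [LHS]mulr_sumr; apply: eq_bigr => y _. by rewrite mulrACA.
have -> : expect (fun x => F x * G x) =
    \sum_(z : _ * _) bern z.1 * bern z.2 * (F z.1 * G z.1).
  rewrite -[LHS]mulr1 -[X in _ * X](expect_cst 1) /expect [LHS]mulr_suml.
  rewrite -(pair_bigA _ (fun x y => bern x * bern y * (F x * G x))) /=.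
  by apply: eq_bigr => x _; rewrite mulr_sumr; apply: eq_bigr => y _; rewrite mulrACA mulr1.
rewrite (reindex_inj (inv_inj swK)) /=; apply: eq_bigr => -[x y] _ /=; congr (_ * (_ * _)).
- rewrite /bern -2!big_split /=; apply: eq_bigr => i _; rewrite !ffunE.
  by case: ifP => _; rewrite // mulrC.
- by apply: dF => i iA; rewrite ffunE iA.
- by apply: dG => i; rewrite inE ffunE => /negbTE ->.
Qed.

Lemma expect_prod_indep (K : finType) (J : {set K}) (A : K -> {set I})
    (F : K -> {ffun I -> bool} -> R) :
  {in J &, forall v w, v != w -> [disjoint A v & A w]} ->
  (forall v, depends_on (A v) (F v)) ->
  expect (fun x => \prod_(v in J) F v x) = \prod_(v in J) expect (F v).
Proof.
move=> + dF; elim: {J}#|J| {-2}J (erefl #|J|) => [|j IH] J.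
  move/eqP; rewrite cards_eq0 => /eqP-> _; rewrite big_set0 -[RHS]expect_cst.
  by apply: eq_expect => x; rewrite big_set0.
move=> cJ dA; have /card_gt0P[v vJ] : (0 < #|J|)%N by rewrite cJ.
rewrite (big_setD1 v vJ) /= -IH; first last.
- by move=> u w /setD1P[_ uJ] /setD1P[_ wJ]; apply: dA.
- by move: cJ; rewrite (cardsD1 v) vJ => -[].
rewrite -(expect_indep (A := A v)) //.
  by apply: eq_expect => x; rewrite (big_setD1 v vJ).
move=> x y xy; apply: eq_bigr => w /setD1P[wv wJ]; apply: dF => i iw.
by apply: xy; rewrite inE (disjointFr (dA _ _ wJ vJ wv) iw).
Qed.

Lemma expect_cylinder A x0 c : 0 <= c -> (forall i, i \in A -> c <= bern1 (x0 i)) ->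
  c ^+ #|A| <= expect (fun x => [forall i in A, x i == x0 i]%:R).
Proof.
move=> c0 cA.
have E x : [forall i in A, x i == x0 i]%:R =
    \prod_i (if i \in A then (x i == x0 i)%:R else 1) :> R.
  rewrite -big_mkcond /=; case: forallP => [H|H].
    by rewrite big1 // => i iA; move: (H i); rewrite iA /= => ->.
  case: (boolP [exists i in A, x i != x0 i]) => [/exists_inP[i iA ne]|].
    by rewrite (bigD1 i) //= (negbTE ne) mul0r.
  rewrite negb_exists_in => /forall_inP nn; case: H => i; apply/implyP => iA.
  by move: (nn i iA); rewrite negbK.
under eq_expect do rewrite E.
rewrite (expect_prod (fun i b => if i \in A then (b == x0 i)%:R else 1)).
rewrite -prodr_const big_mkcond /=; apply: ler_prod => i _.
case: ifP => iA; last by rewrite ler01 /=; lra.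
by rewrite c0; apply: le_trans (cA i iA) _; case: (x0 i) => /=; lra.
Qed.

(* The exponential moment method with base 2. *)
Lemma few_events_le (K : finType) (J : {set K}) (A : K -> {set I})
    (E : K -> {ffun I -> bool} -> bool) (q : R) (t : nat) :
  {in J &, forall v w, v != w -> [disjoint A v & A w]} ->
  (forall v, depends_on (A v) (E v)) ->
  (forall v, v \in J -> q <= expect (fun x => (E v x)%:R)) ->
  expect (fun x => (#|[set v in J | E v x]| < t)%N%:R) <= 2 ^+ t * (1 - q / 2) ^+ #|J|.
Proof.
move=> dA dE qE.
(* Each event contributes a factor 1/2, so [2 ^+ t] times the product is at least 1 when fewer than
   [t] events occur; each factor has mean at most 1 - q/2. *)
pose F v x : R := if E v x then 2^-1 else 1.
have dF v : depends_on (A v) (F v) by move=> x y xy; rewrite /F (dE v x y xy).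
apply: (@le_trans _ _ (expect (fun x => 2 ^+ t * \prod_(v in J) F v x))).
  apply: ler_expect => x.
  have -> : \prod_(v in J) F v x = 2^-1 ^+ #|[set v in J | E v x]|.
    rewrite -prodr_const -big_mkcondr /=; apply: eq_bigl => v.
    by rewrite inE.
  case: ltnP => [lt|_]; last by rewrite mulr_ge0 ?exprn_ge0 ?invr_ge0.
  rewrite exprVn -[t in 2 ^+ t](subnK (ltnW lt)) exprD mulfK ?expf_neq0 ?pnatr_eq0 //.
  by rewrite exprn_ege1 // ler1n.
rewrite expectZ ler_wpM2l ?exprn_ge0 // (expect_prod_indep dA dF) -prodr_const.
apply: ler_prod => v vJ; apply/andP; split.
  rewrite -(expect_cst 0); apply: ler_expect => x.
  by rewrite /F; case: ifP => _; rewrite ?invr_ge0.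
have -> : expect (F v) = expect (fun x => 1 + - 2^-1 * (E v x)%:R).
  by apply: eq_expect => x; rewrite /F; case: ifP => _ /=; lra.
by rewrite expectD expect_cst expectZ; have := qE v vJ; lra.
Qed.

End Bernoulli.

(** The inequality (1 - 1/M)^j (1 + j/M) <= 1 at j = M shows that every block of [M] factors at
    least halves the product. *)
Lemma expr_half_le (R : realFieldType) (M N : nat) : (0 < M)%N ->
  (1 - 1 / M%:R) ^+ N <= 1 / 2 ^+ (N %/ M) :> R.
Proof.
move=> M0; have M0R : 0 < M%:R :> R by rewrite ltr0n.
have M1R : 1 <= M%:R :> R by rewrite ler1n.
set q := 1 - _; have iM : 1 / M%:R <= 1 :> R by rewrite ler_pdivrMr // mul1r.
have q0 : 0 <= q by rewrite subr_ge0.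
have iM0 : 0 < 1 / M%:R :> R by rewrite divr_gt0.
have bernoulli (j : nat) : q ^+ j * (1 + j%:R / M%:R) <= 1.
  elim: j => [|j IH]; first by rewrite expr0 mul0r addr0 mulr1.
  apply: le_trans IH; rewrite exprSr -mulrA ler_wpM2l ?exprn_ge0 //.
  have -> : j.+1%:R / M%:R = j%:R / M%:R + 1 / M%:R :> R by rewrite -natr1 mulrDl.
  rewrite /q; move: iM0 iM; set z := 1 / _ => z0 z1.
  have : 0 <= j%:R / M%:R * z by rewrite mulr_ge0 ?divr_ge0 // ltW.
  by move: (j%:R / _) => y; nra.
have half : q ^+ M <= 2^-1.
  by have := bernoulli M; rewrite divff ?gt_eqF //; move: (q ^+ M) => z; lra.
rewrite {1}(divn_eq N M) exprD mulnC exprM.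
apply: (@le_trans _ _ (2^-1 ^+ (N %/ M))); last by rewrite exprVn div1r.
rewrite -[leRHS]mulr1 ler_pM ?exprn_ge0 //.
  by rewrite lerXn2r ?nnegrE ?exprn_ge0 ?invr_ge0.
by rewrite exprn_ile1 // /q; lra.
Qed.

(** * Events under the two distributions, and comparison of D_k with a Bernoulli product *)

Lemma bern1_half (R : realFieldType) (b : bool) : bern1 (2^-1 : R) b = 2^-1.
Proof. by rewrite /bern1; case: b; lra. Qed.

Lemma bern_half (R : realFieldType) (I : finType) (x : {ffun I -> bool}) :
  bern (2^-1 : R) x = 2^-1 ^+ #|I|.
Proof.
rewrite /bern (eq_bigr (fun=> 2^-1)) ?prodr_const ?cardT //.
by move=> i _; rewrite bern1_half.
Qed.

Lemma push_unif_event (R : realType) (m n : nat)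
    (f : {ffun 'I_m -> bool} -> {ffun 'I_n -> bool}) (P : pred {ffun 'I_n -> bool}) :
  \sum_(y | P y) push_unif R f y = expect (2^-1 : R) (fun x => (P (f x))%:R).
Proof.
have E y : push_unif R f y = \sum_x 2^-1 ^+ m * (f x == y)%:R.
  rewrite /push_unif -mulr_sumr natrX exprVn mulrC; congr (_ * _).
  rewrite -sum1_card natr_sum big_mkcond; apply: eq_bigr => x _.
  by rewrite inE; case: eqP.
under eq_bigr do rewrite E; rewrite exchange_big /=; apply: eq_bigr => x _.
rewrite -mulr_sumr bern_half card_ord; congr (_ * _).
rewrite big_mkcond (bigD1 (f x)) //= eqxx big1 ?addr0 => [|y]; first by case: (P _).
by rewrite eq_sym => /negbTE->; case: (P y).
Qed.

Lemma sum_Dk (R : realType) (n k : nat) : (k <= n)%N -> \sum_y @Dk R n k y = 1.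
Proof.
move=> kn; pose g (y : {ffun 'I_n -> bool}) := [set i | y i].
have gbij : bijective g.
  exists (fun A : {set 'I_n} => [ffun i => i \in A]) => [y|A].
    by apply/ffunP => i; rewrite ffunE inE.
  by apply/setP => i; rewrite inE ffunE.
have cd : #|[set y : {ffun 'I_n -> bool} | weight y == k]| = 'C(n, k).
  rewrite -[in RHS](card_ord n) -(card_draws 'I_n k).
  rewrite -(on_card_preimset (f := g)); last exact: onW_bij.
  by apply: eq_card => y; rewrite !inE.
have num : \sum_(y : {ffun 'I_n -> bool}) (weight y == k)%:R = 'C(n, k)%:R :> R.
  rewrite -cd -sum1_card natr_sum [RHS]big_mkcond; apply: eq_bigr => y _.
  by rewrite inE; case: eqP.
by rewrite /Dk -mulr_suml num divff // pnatr_eq0 -lt0n bin_gt0.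
Qed.

Lemma tvd_event (R : realType) (T : finType) (p q : T -> R) (P : pred T) :
  \sum_y p y = 1 -> \sum_y q y = 1 ->
  \sum_(y | P y) q y - \sum_(y | P y) p y <= tvd p q.
Proof.
move=> p1 q1.
have : \sum_(y | ~~ P y) (p y - q y) = \sum_(y | P y) (q y - p y).
  rewrite !sumrB; move: p1 q1; rewrite (bigID P) /= [in X in _ -> X -> _](bigID P) /=.
  lra.
move=> e; rewrite -sumrB /tvd [in leRHS](bigID P) /=.
have : \sum_(y | P y) (q y - p y) <= \sum_(y | P y) `|p y - q y|.
  by apply: ler_sum => y _; rewrite distrC ler_norm.
have : \sum_(y | ~~ P y) (p y - q y) <= \sum_(y | ~~ P y) `|p y - q y|.
  by apply: ler_sum => y _; rewrite ler_norm.
by rewrite e; lra.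
Qed.

(** Here [c j] is n^n times the probability of [j] under the binomial law with parameters n and k/n.
    It increases up to [k] and decreases afterwards, so the largest of the n + 1 terms, which sum to
    n^n, is [c k]. *)
Lemma binomial_mode (n k : nat) : (k <= n)%N ->
  (n ^ n <= n.+1 * ('C(n, k) * ((n - k) ^ (n - k) * k ^ k)))%N.
Proof.
move=> kn; pose c j := ('C(n, j) * ((n - k) ^ (n - j) * k ^ j))%N.
have up j : (j < k)%N -> (c j <= c j.+1)%N.
  move=> jk; rewrite /c expnS -[(n - j)%N]prednK ?subn_gt0 ?(leq_trans jk) // expnS subnS.
  set u := ((n - k) ^ _)%N; set w := (k ^ j)%N.
  suff : ('C(n, j) * (n - k) <= 'C(n, j.+1) * k)%N.
    by move=> /(leq_mul (leqnn (u * w)%N)); lia.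
  rewrite -(leq_pmul2l (ltn0Sn j)) [X in (_ <= X)%N]mulnA mul_bin_left.
  have : (j.+1 * (n - k) <= k * (n - j))%N by rewrite leq_mul // leq_sub2l // ltnW.
  by move=> /(leq_mul (leqnn 'C(n, j))); lia.
have down j : (k <= j < n)%N -> (c j.+1 <= c j)%N.
  move=> /andP[kj jn]; rewrite /c expnS -[(n - j)%N in X in (_ <= X)%N]prednK ?subn_gt0 // expnS subnS.
  set u := ((n - k) ^ _)%N; set w := (k ^ j)%N.
  suff : ('C(n, j.+1) * k <= 'C(n, j) * (n - k))%N.
    by move=> /(leq_mul (leqnn (u * w)%N)); lia.
  rewrite -(leq_pmul2l (ltn0Sn j)) [X in (X <= _)%N]mulnA mul_bin_left.
  have : (k * (n - j) <= j.+1 * (n - k))%N by rewrite leq_mul ?leq_sub2l // ltnW.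
  by move=> /(leq_mul (leqnn 'C(n, j))); lia.
have cmax j : (j <= n)%N -> (c j <= c k)%N.
  case: (leqP j k) => [jk _|/ltnW kj].
    rewrite -(subKn jk); elim: (k - j)%N (leq_subr j k) => [|i IH] ik; first by rewrite subn0.
    by apply: leq_trans (IH (ltnW ik)); rewrite -(subnSK ik) up //; lia.
  rewrite -(subnKC kj); elim: (j - k)%N => [|i IH]; first by rewrite addn0.
  by rewrite addnS => h; apply: leq_trans (IH (ltnW h)); apply: down; rewrite leq_addr.
rewrite -{1}(subnK kn) expnDn.
apply: (@leq_trans (\sum_(i < n.+1) c k)); last by rewrite sum_nat_const card_ord.
by apply: leq_sum => i _; apply: cmax; rewrite -ltnS.
Qed.

Lemma bern_weight (R : realFieldType) (n : nat) (p : R) (y : {ffun 'I_n -> bool}) :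
  bern p y = p ^+ weight y * (1 - p) ^+ (n - weight y).
Proof.
rewrite /bern (bigID y) /=; congr (_ * _).
  rewrite (eq_bigr (fun=> p)) => [|i ->//]; rewrite prodr_const; congr (_ ^+ _).
  by apply: eq_card => i; rewrite inE.
rewrite (eq_bigr (fun=> 1 - p)) => [|i /negbTE->//]; rewrite prodr_const; congr (_ ^+ _).
have wn : (weight y + #|[predC [set i | y i]]| = n)%N by rewrite cardC card_ord.
have -> : (n - weight y = #|[predC [set i | y i]]|)%N by lia.
by apply: eq_card => i; rewrite !inE.
Qed.

(** The Bernoulli(k/n) product conditioned on weight [k] is D_k, and by [binomial_mode] this
    conditioning costs a factor of at most n + 1. *)
Lemma Dk_le_bern (R : realType) (n k : nat) (y : {ffun 'I_n -> bool}) :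
  (0 < n)%N -> (k <= n)%N -> Dk R k y <= n.+1%:R * bern (k%:R / n%:R) y.
Proof.
move=> n0 kn; rewrite /Dk.
have nR : 0 < n%:R :> R by rewrite ltr0n.
have p1 : k%:R / n%:R <= 1 :> R by rewrite ler_pdivrMr // mul1r ler_nat.
have p0 : 0 <= k%:R / n%:R :> R by rewrite divr_ge0.
case: eqP => [wy|_]; last by rewrite mul0r mulr_ge0 // bern_ge0 // p0.
have C0 : 0 < 'C(n, k)%:R :> R by rewrite ltr0n bin_gt0.
rewrite bern_weight wy ler_pdivrMr //= mulr1n.
have -> : 1 - k%:R / n%:R = (n - k)%:R / n%:R :> R.
  by rewrite natrB // mulrBl divff // gt_eqF.
rewrite !expr_div_n mulf_div -exprD subnKC //.
have nn : 0 < n%:R ^+ n :> R by rewrite exprn_gt0.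
rewrite mulrA mulrAC ler_pdivlMr // mul1r -!natrX -!natrM ler_nat.
by apply: leq_trans (binomial_mode kn) _; apply: eq_leq; ring.
Qed.


(** * Anticoncentration of the weight under random shifts *)

Section Shift.

Variables (R : realType) (m n d : nat).
Variable f : {ffun 'I_m -> bool} -> {ffun 'I_n -> bool}.
Variables (N B : 'I_n -> {set 'I_m}) (J : {set 'I_n}).
Hypothesis fN : forall u, depends_on (N u) (fun x => f x u).
Hypothesis Bd : forall v, (#|B v| <= d)%N.

(** These outputs may react to the block of inputs [B v]; the first disjunct keeps [v] itself even
    when [B v] is empty. *)
Definition nbhd (v : 'I_n) : {set 'I_n} := [set u | (u == v) || (N u :&: B v != set0)].

Hypothesis nbhd_disj : {in J &, forall v w, v != w -> [disjoint nbhd v & nbhd w]}.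
Hypothesis BN : forall v, B v \subset N v.

Implicit Types (x s : {ffun 'I_m -> bool}) (T : {set 'I_n}).

(** [s] holds the flip pattern and [T] the blocks to which it is applied. The exclusive or makes
    this an involution in [x], so the uniform law is preserved. *)
Definition shift x s T : {ffun 'I_m -> bool} :=
  [ffun i => x i (+) (s i && [exists v in T, i \in B v])].

Lemma mem_nbhd u v i : i \in N u -> i \in B v -> u \in nbhd v.
Proof.
move=> iN iB; rewrite inE; apply/orP; right; apply/set0Pn; exists i.
by rewrite inE iN.
Qed.

Lemma nbhd_inj u v w : v \in J -> w \in J -> u \in nbhd v -> u \in nbhd w -> v = w.
Proof.
move=> vJ wJ uv uw; apply/eqP; apply: contraTT uw => vw.
by rewrite (disjointFr (nbhd_disj vJ wJ vw) uv).
Qed.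

Lemma B_disj : {in J &, forall v w, v != w -> [disjoint B v & B w]}.
Proof.
move=> v w vJ wJ vw; rewrite -setI_eq0; apply/set0Pn => -[i /setIP[iv iw]].
case/eqP: vw; apply: (nbhd_inj (u := v)) => //; first by rewrite inE eqxx.
by apply: mem_nbhd iw; apply: subsetP (BN v) _ iv.
Qed.

Lemma f_shift_eq x s u T T' :
  (forall w, u \in nbhd w -> (w \in T) = (w \in T')) ->
  f (shift x s T) u = f (shift x s T') u.
Proof.
move=> TT'; apply: fN => i iN; rewrite !ffunE; congr (_ (+) (_ && _)).
apply: eq_existsb => w; case: (boolP (i \in B w)) => iB; rewrite ?andbF // !andbT.
by apply: TT'; apply: mem_nbhd iB.
Qed.

Lemma shift0 x s : shift x s set0 = x.
Proof.
apply/ffunP => i; rewrite ffunE [X in _ && X](_ : _ = false) ?andbF ?addbF //.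
by apply/existsP => -[w]; rewrite inE.
Qed.

Lemma shiftK s T : involutive (fun x => shift x s T).
Proof. by move=> x; apply/ffunP => i; rewrite !ffunE addbK. Qed.

Definition weight_change v x s : int :=
  \sum_(u in nbhd v) ((f (shift x s [set v]) u : nat)%:Z - (f x u : nat)%:Z).

Lemma weight_sum (y : {ffun 'I_n -> bool}) : (weight y)%:Z = \sum_u (y u : nat)%:Z.
Proof.
rewrite /weight -sum1_card (big_morph Posz (id1 := 0) (op1 := +%R)) //.
by rewrite big_mkcond /=; apply: eq_bigr => u _; rewrite inE; case: (y u).
Qed.

(** Neighbourhoods of members of [J] are disjoint, so every output reacts to at most one switched
    block and the changes add up. *)
Lemma weight_shift x s T : T \subset J ->
  (weight (f (shift x s T)))%:Z = (weight (f x))%:Z + \sum_(v in T) weight_change v x s.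
Proof.
move=> /subsetP TJ; apply/eqP; rewrite addrC -subr_eq !weight_sum -sumrB; apply/eqP.
pose D u : int := (f (shift x s T) u : nat)%:Z - (f x u : nat)%:Z.
have -> : \sum_(v in T) weight_change v x s = \sum_(v in T) \sum_(u in nbhd v) D u.
  apply: eq_bigr => v vT; apply: eq_bigr => u uv; congr (Posz (nat_of_bool _) - _).
  apply: f_shift_eq => w uw; rewrite inE; apply/eqP/idP => [->//|wT].
  by apply: nbhd_inj uw uv; apply: TJ.
rewrite (exchange_big_dep xpredT) //=; apply: eq_bigr => u _; rewrite -/(D u).
case: (boolP [exists v in T, u \in nbhd v]) => [/exists_inP[v vT uv]|nx].
  rewrite (bigD1 v) /= ?vT // big1 ?addr0 // => w /andP[/andP[wT uw] wv].
  by case/eqP: wv; apply: nbhd_inj uw uv; apply: TJ.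
rewrite big_pred0 => [|v]; last first.
  by apply/negP => uv; case/negP: nx; apply/exists_inP; exists v; case/andP: uv.
rewrite /D (_ : f (shift x s T) u = f x u) ?subrr // -{2}(shift0 x s).
apply: f_shift_eq => w uw; rewrite inE; apply: contraNF nx => wT.
by apply/exists_inP; exists w.
Qed.

(** Switching an already switched block undoes its change, hence the sign. Therefore [unstable] is
    the same at all shifts of [x]. *)
Lemma weight_change_shift x s T v : T \subset J -> v \in J ->
  weight_change v (shift x s T) s = (-1) ^+ (v \in T) * weight_change v x s.
Proof.
move=> /subsetP TJ vJ; rewrite mulr_sumr; apply: eq_bigr => u uv.
have eT : f (shift x s T) u = if v \in T then f (shift x s [set v]) u else f x u.
  case: ifP => vT; first apply: f_shift_eq => w uw.
    rewrite inE; apply/idP/eqP => [wT|->//].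
    by apply: nbhd_inj uw uv => //; apply: TJ.
  rewrite -{2}(shift0 x s); apply: f_shift_eq => w uw; rewrite inE.
  by apply: contraFF vT => wT; rewrite -(nbhd_inj (TJ _ wT) vJ uw uv).
have eTv : f (shift (shift x s T) s [set v]) u =
           if v \in T then f x u else f (shift x s [set v]) u.
  have ev i : [exists w in [set v], i \in B w] = (i \in B v).
    apply/exists_inP/idP => [[w /set1P->//]|iB]; by exists v; rewrite ?set11.
  have eTi i : i \in N u -> [exists w in T, i \in B w] = (v \in T) && (i \in B v).
    move=> iN; apply/exists_inP/andP => [[w wT iB]|[vT iB]]; last by exists v.
    by rewrite -(nbhd_inj (TJ _ wT) vJ (mem_nbhd iN iB) uv).
  case: ifP => vT; apply: fN => i iN; rewrite !ffunE ev eTi // vT /=.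
    by rewrite addbK.
  by rewrite andbF addbF.
by rewrite eT eTv; case: (v \in T); rewrite /= ?expr1 ?expr0 ?mul1r // mulN1r opprB.
Qed.

Definition unstable x s : {set 'I_n} := [set v in J | weight_change v x s != 0].

Lemma unstable_shift x s T : T \subset J -> unstable (shift x s T) s = unstable x s.
Proof.
move=> TJ; apply/setP => v; rewrite !inE; case: (boolP (v \in J)) => //= vJ.
by rewrite weight_change_shift // mulf_eq0 signr_eq0.
Qed.

Let half01 : 0 <= (2^-1 : R) <= 1.
Proof. by apply/andP; split; lra. Qed.

Local Notation E := (@expect R 'I_m 2^-1).

Lemma expect_shift (F : {ffun 'I_m -> bool} -> R) s T :
  E (fun x => F (shift x s T)) = E F.
Proof.
rewrite /expect [RHS](reindex_inj (inv_inj (@shiftK s T))) /=.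
by apply: eq_bigr => x _; rewrite !bern_half.
Qed.

(** For fixed [s], replacing [x] by [shift x s T] preserves the law, so one may average over all
    subsets [T] of [J]. For each [x] the weight is then a constant plus a random subset sum, to
    which [littlewood_offord] applies. *)
Lemma weight_unstable_le (k l : nat) s :
  E (fun x => ((weight (f x) == k) && (l <= #|unstable x s|)%N)%:R) <=
  1 / Num.sqrt l.+1%:R.
Proof.
pose F x : R := ((weight (f x) == k) && (l <= #|unstable x s|)%N)%:R.
have P0 : 0 < 2 ^+ #|J| :> R by rewrite exprn_gt0.
rewrite -(ler_pM2l P0) -expectZ.
have -> : E (fun x => 2 ^+ #|J| * F x) =
    E (fun x => \sum_(T in powerset J) F (shift x s T)).
  rewrite expectZ [RHS]/expect; under [RHS]eq_bigr do rewrite mulr_sumr.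
  rewrite exchange_big /= [RHS](eq_bigr (fun=> E F)) => [|T _]; last exact: expect_shift.
  by rewrite sumr_const card_powerset -[RHS]mulr_natl natrX.
rewrite -[leRHS](expect_cst 'I_m (2^-1 : R)); apply: ler_expect => // x.
have [ll|ll] := leqP l #|unstable x s|; last first.
  rewrite big1 => [|T]; first by rewrite mulr_ge0 ?divr_ge0 ?sqrtr_ge0 ?exprn_ge0.
  by rewrite inE => TJ; rewrite /F unstable_shift // leqNgt ll andbF.
have := littlewood_offord (fun v => weight_change v x s) J (k%:Z - (weight (f x))%:Z).
set c := #|[set T in powerset J | _]|.
have -> : \sum_(T in powerset J) F (shift x s T) = c%:R.
  rewrite /c -sum1_card natr_sum big_mkcond [RHS]big_mkcond; apply: eq_bigr => T _.
  rewrite !inE; case: (boolP (T \subset J)) => //= TJ.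
  rewrite /F unstable_shift // ll andbT -eqz_nat weight_shift //.
  by rewrite [X in if X then _ else _]eq_sym subr_eq addrC eq_sym; case: eqP.
rewrite -/(unstable x s) => h.
have {}h : (c ^ 2 * l.+1 <= 4 ^ #|J|)%N by apply: leq_trans h; rewrite leq_mul2l ltnS ll orbT.
rewrite mulrA mulr1 ler_pdivlMr ?sqrtr_gt0 ?ltr0n //.
rewrite -(ler_pXn2r (n := 2)) ?nnegrE ?mulr_ge0 ?sqrtr_ge0 ?exprn_ge0 //.
rewrite exprMn sqr_sqrtr ?ler0n // -exprM mulnC exprM -!natrX -natrM ler_nat.
by [].
Qed.

Definition movable x : {set 'I_n} := [set v in J | [exists s, weight_change v x s != 0]].

Lemma weight_change_depends v x : depends_on (B v) (weight_change v x).
Proof.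
move=> s s' ss'; apply: eq_bigr => u _; congr (Posz (nat_of_bool (f _ u)) - _).
apply/ffunP => i; rewrite !ffunE; congr (_ (+) _).
case: (boolP (i \in B v)) => [/ss'->//|iB].
have -> : [exists w in [set v], i \in B w] = false.
  by apply/exists_inP => -[w /set1P->]; apply/negP.
by rewrite !andbF.
Qed.

(** For a random [s], the movable outputs become unstable independently, because their blocks are
    disjoint, and each with probability at least 2^-d. *)
Lemma few_unstable_le (t l : nat) x : (t <= #|movable x|)%N ->
  E (fun s => (#|unstable x s| < l)%N%:R) <= 2 ^+ l * (1 - 2^-1 ^+ d / 2) ^+ t.
Proof.
move=> tx; have mJ v : v \in movable x -> v \in J by rewrite inE => /andP[].
have p1 : 2^-1 ^+ d <= 1 :> R by rewrite exprn_ile1 //; lra.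
have p0 : 0 <= 2^-1 ^+ d :> R by rewrite exprn_ge0 //; lra.
apply: (@le_trans _ _ (2 ^+ l * (1 - 2^-1 ^+ d / 2) ^+ #|movable x|)); last first.
  rewrite ler_wpM2l ?exprn_ge0 // -(subnK tx) exprD -[leRHS]mul1r ler_wpM2r //.
    by rewrite exprn_ge0 //; lra.
  by rewrite exprn_ile1 //; lra.
have eqU s : unstable x s = [set v in movable x | weight_change v x s != 0].
  apply/setP => v; rewrite !inE -andbA; congr andb.
  by apply/idP/andP => [h|[]//]; split=> //; apply/existsP; exists s.
under eq_expect do rewrite eqU.
apply: (@few_events_le R 'I_m _ half01 _ _ B) => //.
- by move=> v w /mJ vJ /mJ wJ; apply: B_disj.
- by move=> v s s' ss'; rewrite (@weight_change_depends v x s s' ss').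
(* Agreement of [s] with the witness [s0] on the at most [d] inputs of [B v] already forces a
   nonzero change. *)
move=> v; rewrite inE => /andP[vJ /existsP[s0 s0P]].
apply: (@le_trans _ _ (2^-1 ^+ #|B v|)).
  by apply: ler_wiXn2l (Bd v); rewrite ?invr_ge0 //; lra.
apply: le_trans (@expect_cylinder R 'I_m 2^-1 (B v) s0 2^-1 _ _) _.
- by lra.
- by move=> i _; rewrite bern1_half.
apply: ler_expect => // s; rewrite ler_nat.
case: (boolP [forall i in B v, s i == s0 i]) => //= /forall_inP ss0.
by rewrite (@weight_change_depends v x s s0) ?s0P // => i /ss0/eqP.
Qed.

(** The event does not involve [s], so one averages over an independent uniform [s] and splits
    according to whether at least [l] outputs are unstable. *)
Lemma weight_movable_le (k t l : nat) :
  E (fun x => ((weight (f x) == k) && (t <= #|movable x|)%N)%:R) <=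
  1 / Num.sqrt l.+1%:R + 2 ^+ l * (1 - 2^-1 ^+ d / 2) ^+ t.
Proof.
pose G x s : R := ((weight (f x) == k) && (l <= #|unstable x s|)%N)%:R.
pose H x s : R := (t <= #|movable x|)%N%:R * (#|unstable x s| < l)%N%:R.
apply: (@le_trans _ _ (E (fun x => E (fun s => G x s) + E (fun s => H x s)))).
  apply: ler_expect => // x; rewrite -expectD -[leLHS](expect_cst 'I_m (2^-1 : R)).
  apply: ler_expect => // s; rewrite /G /H ltnNge.
  by case: (_ == k); case: (t <= _)%N; case: (l <= _)%N => /=; lra.
rewrite expectD lerD //.
  rewrite /expect; under eq_bigr do rewrite mulr_sumr.
  rewrite exchange_big /= -[leRHS](expect_cst 'I_m (2^-1 : R)).
  apply: ler_sum => s _.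
  under eq_bigr do rewrite mulrCA; rewrite -mulr_sumr ler_wpM2l ?bern_ge0 //.
  exact: weight_unstable_le.
rewrite -[leRHS](expect_cst 'I_m (2^-1 : R)); apply: ler_expect => // x.
have p1 : 2^-1 ^+ d <= 1 :> R by rewrite exprn_ile1 //; lra.
rewrite expectZ; case: (leqP t #|movable x|) => [/few_unstable_le|_].
  by rewrite mul1r; apply.
by rewrite mul0r mulr_ge0 ?exprn_ge0 //; lra.
Qed.



(** * Outputs whose neighbourhood is hit *)

Definition always x v : bool := [forall z, f (mix (B v) z x) v].

(** [y] is kept apart from [f x] so that the same test makes sense for a string drawn from D_k. *)
Definition hit x (y : {ffun 'I_n -> bool}) v : bool :=
  if always x v then ~~ y v else [forall u in nbhd v, y u].

Lemma mem_nbhd_self v : v \in nbhd v.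
Proof. by rewrite inE eqxx. Qed.

(* When all of [nbhd v] outputs 1, switching [v] to 0 strictly decreases the weight. *)
Lemma hit_movable x v : v \in J -> hit x (f x) v -> v \in movable x.
Proof.
rewrite /hit inE => -> /=; case: ifP => [/forallP /(_ x)|/negbT].
  suff -> : mix (B v) x x = x by move=> ->.
  by apply/ffunP => i; rewrite ffunE; case: ifP.
move=> /forallPn[z fz] /forall_inP ones.
apply/existsP; exists [ffun i => x i (+) z i].
have sh : shift x [ffun i => x i (+) z i] [set v] = mix (B v) z x.
  apply/ffunP => i; rewrite !ffunE.
  have -> : [exists w in [set v], i \in B w] = (i \in B v).
    by apply/exists_inP/idP => [[w /set1P->//]|iB]; exists v; rewrite ?set11.
  by case: (i \in B v); rewrite ?andbT ?andbF ?addbF // addKb.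
rewrite lt_eqF // /weight_change (bigD1 v) ?mem_nbhd_self //= sh (negbTE fz).
rewrite (ones v (mem_nbhd_self v)) /= -[ltRHS]addr0 ltr_leD // sumr_le0 // => u /andP[uv _].
by rewrite (ones u uv); case: (f _ u).
Qed.

Lemma hit_depends x v : depends_on (nbhd v) (fun y => hit x y v).
Proof.
move=> y y' yy'; rewrite /hit (yy' v (mem_nbhd_self v)); congr (if _ then _ else _).
by apply: eq_forallb_in => u uv; rewrite yy'.
Qed.

Variable S : {set 'I_m}.
Hypothesis NBS : forall v, v \in J -> N v \subset B v :|: S.

Lemma hit_eq x x' y v : v \in J -> (forall i, i \in S -> x i = x' i) ->
  hit x y v = hit x' y v.
Proof.
move=> vJ xx'; rewrite /hit; congr (if _ then _ else _).
apply: eq_forallb => z; apply: fN => i iN; rewrite !ffunE.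
case: ifP => // /negbT iB; apply: xx'.
by have := subsetP (NBS vJ) i iN; rewrite inE (negbTE iB).
Qed.

Variables (a : nat) (p : R).
Hypotheses (p0 : 0 < p) (p_half : p <= 2^-1) (a0 : (0 < a)%N).
Hypothesis nbhd_a : forall v, v \in J -> (#|nbhd v| <= a)%N.

Let p01 : 0 <= p <= 1.
Proof. by have [p_gt0 p_le] := (p0, p_half); apply/andP; split; lra. Qed.

(** Hits depend on disjoint sets of coordinates of [y]. Each has probability at least p^a: in the
    first case 1 - p >= p >= p^a, in the second p to the size of [nbhd v]. *)
Lemma few_hits_le (t : nat) x :
  expect p (fun y => (#|[set v in J | hit x y v]| < t)%N%:R) <=
  2 ^+ t * (1 - p ^+ a / 2) ^+ #|J|.
Proof.
apply: (@few_events_le R _ _ p01 _ _ nbhd) => //.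
  by move=> v; apply: hit_depends.
have [p_gt0 p_le] := (p0, p_half); move=> v vJ; rewrite /hit; case: (always x v).
  apply: (@le_trans _ _ (1 - p)).
    apply: (@le_trans _ _ p); last by lra.
    by rewrite -[leRHS]expr1; apply: ler_wiXn2l => //; lra.
  have := @expect_cylinder R 'I_n p [set v] [ffun=> false] (1 - p).
  rewrite cards1 expr1 => /(_ _ _)/le_trans -> //.
  - by lra.
  - by move=> i _; rewrite ffunE.
  apply: ler_expect => // y; rewrite ler_nat.
  case: (boolP [forall i in [set v], _]) => //= /forall_inP /(_ v (set11 v)).
  by rewrite ffunE => /eqP->.
apply: (@le_trans _ _ (p ^+ #|nbhd v|)).
  by apply: ler_wiXn2l (nbhd_a vJ); lra.
have := @expect_cylinder R 'I_n p (nbhd v) [ffun=> true] p.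
move=> /(_ _ _)/le_trans -> //.
- by lra.
- by move=> i _; rewrite ffunE.
apply: ler_expect => // y; rewrite ler_nat.
case: (boolP [forall i in nbhd v, _ == _]) => //= /forall_inP h.
by case: (boolP [forall u in nbhd v, y u]) => // /forall_inPn[u /h]; rewrite ffunE => /eqP->.
Qed.

(** Quantifying over the assignments of [S], encoded by their sets of ones, yields an event in [y]
    alone. Inputs outside [S] are set to 0, which is harmless by [hit_eq]. *)
Definition sparse (t : nat) (y : {ffun 'I_n -> bool}) : bool :=
  [exists rho in powerset S, #|[set v in J | hit [ffun i => i \in rho] y v]| < t]%N.

Lemma sparse_le (t : nat) :
  expect p (fun y => (sparse t y)%:R) <=
  2 ^+ #|S| * (2 ^+ t * (1 - p ^+ a / 2) ^+ #|J|).
Proof.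
pose F (rho : {set 'I_m}) (y : {ffun 'I_n -> bool}) : R :=
  (#|[set v in J | hit [ffun i => i \in rho] y v]| < t)%N%:R.
apply: (@le_trans _ _ (expect p (fun y => \sum_(rho in powerset S) F rho y))).
  apply: ler_expect => // y; rewrite /sparse.
  case: (boolP [exists rho in _, _]) => [/exists_inP[rho rS h]|_]; last first.
    by apply: sumr_ge0 => rho _; rewrite /F ler0n.
  rewrite (bigD1 rho) //= {1}/F h lerDl.
  by apply: sumr_ge0 => r _; rewrite /F ler0n.
rewrite /expect; under eq_bigr do rewrite mulr_sumr.
rewrite exchange_big /= -natrX -card_powerset mulr_natl -sumr_const.
by apply: ler_sum => rho _; apply: few_hits_le.
Qed.

(** Taking for [rho] the true values of [x] on [S] gives at least [t] hits by [f x], and these are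
    movable. *)
Lemma not_sparse_movable (t : nat) x : ~~ sparse t (f x) -> (t <= #|movable x|)%N.
Proof.
rewrite negb_exists_in => /forall_inP /(_ [set i in S | x i]).
rewrite inE -leqNgt => /(_ _)/leq_trans -> //.
  by apply/subsetP => i; rewrite inE => /andP[].
apply/subset_leq_card/subsetP => v; rewrite inE => /andP[vJ hv].
apply: hit_movable => //; rewrite (hit_eq (x' := x)) // in hv => i iS.
by rewrite ffunE inE iS.
Qed.

Lemma tvd_lower_bound (k t l : nat) :
  (0 < n)%N -> (k <= n)%N -> p = k%:R / n%:R ->
  1 - n.+1%:R * (2 ^+ #|S| * (2 ^+ t * (1 - p ^+ a / 2) ^+ #|J|)) -
  (1 / Num.sqrt l.+1%:R + 2 ^+ l * (1 - 2^-1 ^+ d / 2) ^+ t) <=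
  tvd (@push_unif R m n f) (@Dk R n k).
Proof.
move=> n0 kn pE; pose P y := (weight y == k) && ~~ sparse t y.
have sP : \sum_y @push_unif R m n f y = 1.
  by rewrite (push_unif_event R f xpredT) expect_cst.
apply: le_trans (tvd_event P sP (@sum_Dk R n k kn)); apply: lerB.
  rewrite -[X in X - _ <= _](@sum_Dk R n k kn) [X in X - _ <= _](bigID P) /=.
  rewrite -addrA gerDl subr_le0.
  apply: le_trans (ler_wpM2l _ (sparse_le t)); last by rewrite ler0n.
  (* Outside [P] either the weight differs from [k], where D_k vanishes, or [y] is sparse and the
     Bernoulli comparison applies. *)
  rewrite big_mkcond /expect mulr_sumr; apply: ler_sum => y _.
  have := @Dk_le_bern R n k y n0 kn; rewrite -pE.
  have b0 : 0 <= n.+1%:R * bern p y.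
    by rewrite mulr_ge0 ?ler0n // bern_ge0.
  rewrite /P negb_and negbK mulrA; case: (boolP (sparse t y)) => _; rewrite ?mulr1 ?mulr0.
    by case: ifP.
  by rewrite orbF /Dk; case: eqP => //= _ _; rewrite mul0r.
rewrite push_unif_event; apply: le_trans (weight_movable_le k t l).
apply: ler_expect => // x.
rewrite /P ler_nat; case: (_ == k) => //=.
by case: (boolP (sparse t (f x))) => //= /not_sparse_movable ->.
Qed.

End Shift.

(** * Choosing well separated outputs *)

Lemma card_bigcup_le (I T : finType) (A : {set I}) (F : I -> {set T}) (b : nat) :
  (forall i, i \in A -> #|F i| <= b)%N -> (#|\bigcup_(i in A) F i| <= #|A| * b)%N.
Proof.
move=> Fb; apply: (@leq_trans (\sum_(i in A) #|F i|)); last first.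
  by rewrite -sum_nat_const; apply: leq_sum => i; apply: Fb.
apply: (big_ind2 (fun (X : {set T}) (j : nat) => #|X| <= j)%N) => //.
  by rewrite cards0.
by move=> X i Y j Xi Yj; apply: leq_trans (leq_card_setU X Y) _; apply: leq_add.
Qed.

(** In a maximal disjoint family [J], every element of [V] conflicts with some member of [J], and
    each member accounts for at most [b] conflicts. *)
Lemma greedy_disjoint (T U : finType) (V : {set T}) (A : T -> {set U}) (b : nat) :
  (forall v, v \in V -> A v != set0) ->
  (forall v, v \in V -> #|[set w in V | ~~ [disjoint A v & A w]]| <= b)%N ->
  exists J : {set T}, [/\ J \subset V, {in J &, forall v w, v != w -> [disjoint A v & A w]}
    & (#|V| <= #|J| * b)%N].
Proof.
move=> A0 Ab.
pose P (J : {set T}) := (J \subset V) &&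
  [forall v in J, forall w in J, (v != w) ==> [disjoint A v & A w]].
have P0 : P set0.
  by rewrite /P sub0set; apply/forall_inP => v; rewrite inE.
have [J /maxsetP[/andP[JV /forall_inP disJ] maxJ]] := ex_maxset (ex_intro P _ P0).
have disJ' : {in J &, forall v w, v != w -> [disjoint A v & A w]}.
  by move=> v w vJ wJ; apply/implyP; move: w wJ; apply/forall_inP/disJ.
exists J; split => //.
apply: leq_trans (card_bigcup_le (fun v vJ => Ab v (subsetP JV v vJ))).
apply/subset_leq_card/subsetP => w wV; apply/bigcupP.
case: (boolP [exists v in J, ~~ [disjoint A v & A w]]) => [/exists_inP[v vJ vw]|].
  by exists v; rewrite // inE wV.
rewrite negb_exists_in => /forall_inP nJ.
have wJ : w \in J.
  suff <- : w |: J = J by rewrite setU11.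
  apply: maxJ; last exact: subsetUr.
  rewrite /P subUset sub1set wV JV; apply/forall_inP => u.
  rewrite !inE => uJ; apply/forall_inP => v; rewrite !inE => vJ; apply/implyP => uv.
  case/orP: uJ uv => [/eqP->|uJ]; case/orP: vJ => [/eqP->|vJ] uv.
  - by rewrite eqxx in uv.
  - by rewrite disjoint_sym; have := nJ v vJ; rewrite negbK.
  - by have := nJ u uJ; rewrite negbK.
  - exact: disJ'.
(* A member of [J] conflicts with itself, since [A w] is nonempty. *)
by have := nJ w wJ; rewrite negbK -setI_eq0 setIid (negbTE (A0 w wV)).
Qed.

Section Separation.

Variables (m n d : nat) (N : 'I_n -> {set 'I_m}) (tau : nat -> nat).
Hypothesis Nd : forall u, (#|N u| <= d)%N.
Hypothesis tau_mono : forall i j, (i <= j)%N -> (tau i <= tau j)%N.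

Definition deg (x : 'I_m) : nat := #|[set u | x \in N u]|.

Definition avoids (i : nat) (v : 'I_n) : bool :=
  [forall x in N v, (deg x <= tau i) || (tau i.+1 < deg x)]%N.

Lemma sum_deg : (\sum_x deg x <= n * d)%N.
Proof.
have -> : (\sum_x deg x = \sum_u #|N u|)%N.
  rewrite (eq_bigr (fun x => \sum_u (x \in N u))%N) => [|x _]; last first.
    by rewrite /deg -sum1_card big_mkcond; apply: eq_bigr => u _; rewrite inE; case: (_ \in _).
  rewrite exchange_big; apply: eq_bigr => u _ /=.
  by rewrite -sum1_card [RHS]big_mkcond; apply: eq_bigr => x _; case: (_ \in _).
apply: (@leq_trans (\sum_(u : 'I_n) d)); first exact: leq_sum.
by rewrite sum_nat_const card_ord.
Qed.

(** Pigeonhole: otherwise each of the d + 1 disjoint degree layers would contain an input of [v],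
    but there are at most [d] inputs. *)
Lemma avoids_some (v : 'I_n) : exists i : 'I_d.+1, avoids i v.
Proof.
apply/existsP; apply: contraT; rewrite negb_exists => /forallP na.
have /fin_all_exists[h hP] (i : 'I_d.+1) :
    exists x, [&& x \in N v, (tau i < deg x)%N & (deg x <= tau i.+1)%N].
  have := na i; rewrite negb_forall_in => /exists_inP[x xN].
  by rewrite negb_or -ltnNge -leqNgt => H; exists x; rewrite xN.
have hinj : injective h.
  move=> i j hij; apply/val_inj/eqP; rewrite eqn_leq.
  have /and3P[_ i1 i2] := hP i; have /and3P[_ j1 j2] := hP j; rewrite hij in i1 i2.
  apply/andP; split; rewrite leqNgt; apply/negP => /tau_mono.
    by rewrite leqNgt (leq_trans i1 j2).
  by rewrite leqNgt (leq_trans j1 i2).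
have : (d.+1 <= #|N v|)%N.
  rewrite -{1}(card_ord d.+1) -(card_codom hinj); apply/subset_leq_card/subsetP => x.
  by case/codomP => i ->; case/and3P: (hP i).
by rewrite leqNgt ltnS Nd.
Qed.

Lemma avoids_many : exists i : 'I_d.+1, (n <= d.+1 * #|[set v | avoids i v]|)%N.
Proof.
apply/existsP; apply: contraT; rewrite negb_exists => /forallP few.
have : (\sum_(i < d.+1) d.+1 * #|[set v | avoids i v]| < \sum_(i < d.+1) n)%N.
  rewrite big_ord_recl [X in (_ < X)%N]big_ord_recl /= -addSn leq_add //.
    by rewrite ltnNge; apply: (few ord0).
  by apply: leq_sum => i _; apply: ltnW; rewrite ltnNge; apply: (few (lift ord0 i)).
rewrite -big_distrr /= sum_nat_const card_ord ltn_mul2l /= ltnNge.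
suff -> : (n <= \sum_(i < d.+1) #|[set v | avoids i v]|)%N by [].
rewrite (eq_bigr (fun i : 'I_d.+1 => \sum_v avoids i v)%N) => [|i _]; last first.
  by rewrite -sum1_card big_mkcond; apply: eq_bigr => v _; rewrite inE; case: avoids.
rewrite exchange_big /= -{1}(card_ord n) -sum1_card; apply: leq_sum => v _.
by have [i iv] := avoids_some v; rewrite (bigD1 i) //= iv.
Qed.

(** [S] consists of the inputs of degree above [tau i.+1], few by double counting. For an output
    avoiding layer [i], the inputs outside [S] have degree at most [tau i], which bounds
    neighbourhoods and conflicts. *)
Lemma separated_outputs : exists (i : nat) (S : {set 'I_m}) (J : {set 'I_n}),
  let B v := N v :\: S in let a := (d * tau i).+1 in
  [/\ (i <= d)%N, (#|S| * tau i.+1 <= n * d)%N,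
      {in J &, forall v w, v != w -> [disjoint nbhd N B v & nbhd N B w]},
      forall v, v \in J -> (#|nbhd N B v| <= a)%N &
      (n <= d.+1 * (#|J| * (a * a)))%N].
Proof.
have [i iV] := avoids_many; pose V := [set v | avoids i v].
pose S := [set x | tau i.+1 < deg x]%N; pose B v := N v :\: S; pose a := (d * tau i).+1.
have degB v x : v \in V -> x \in B v -> (deg x <= tau i)%N.
  rewrite !inE => /forall_inP av /andP[xS xN].
  by have := av x xN; rewrite (negbTE xS) orbF.
have Bd v : (#|B v| <= d)%N by apply: leq_trans (Nd v); rewrite subset_leq_card ?subsetDl.
have nbhd_a v : v \in V -> (#|nbhd N B v| <= a)%N.
  move=> vV; apply: (@leq_trans #|v |: \bigcup_(x in B v) [set u | x \in N u]|).
    apply/subset_leq_card/subsetP => u; rewrite !inE => /orP[->//|/set0Pn[x /setIP[xN xB]]].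
    by apply/orP; right; apply/bigcupP; exists x => //; rewrite inE.
  rewrite cardsU1 /a -[X in (_ <= X)%N]add1n leq_add ?leq_b1 //.
  apply: leq_trans (card_bigcup_le (fun x => degB v x vV)) _.
  by rewrite leq_mul2r Bd orbT.
(* A conflict between [v] and [w] passes through some [u] in [nbhd v], with at most [a] choices.
   Given [u], either [w] is [u] or they share an input of [B w], of degree at most [tau i]: again at
   most [a] choices. *)
have conf v : v \in V ->
    (#|[set w in V | ~~ [disjoint nbhd N B v & nbhd N B w]]| <= a * a)%N.
  move=> vV.
  apply: (@leq_trans #|\bigcup_(u in nbhd N B v) [set w in V | u \in nbhd N B w]|).
    apply/subset_leq_card/subsetP => w; rewrite inE -setI_eq0 => /andP[wV /set0Pn[u /setIP[uv uw]]].
    by apply/bigcupP; exists u; rewrite // inE wV.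
  apply: (@leq_trans (#|nbhd N B v| * a)); last by rewrite leq_mul2r nbhd_a ?orbT.
  apply: card_bigcup_le => u _.
  apply: (@leq_trans #|u |: \bigcup_(x in N u) [set w in V | x \in B w]|).
    apply/subset_leq_card/subsetP => w; rewrite inE => /andP[wV].
    rewrite !inE => /orP[/eqP->|/set0Pn[x /setIP[xN xB]]]; first by rewrite eqxx.
    by apply/orP; right; apply/bigcupP; exists x => //; rewrite inE wV.
  rewrite cardsU1 /a -[X in (_ <= X)%N]add1n leq_add ?leq_b1 //.
  apply: (@leq_trans (#|N u| * tau i)); last by rewrite leq_mul2r Nd orbT.
  apply: card_bigcup_le => x _.
  case: (set_0Vmem [set w in V | x \in B w]) => [->|[w]]; first by rewrite cards0.
  rewrite inE => /andP[wV xB]; apply: leq_trans (degB w x wV xB).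
  apply/subset_leq_card/subsetP => w'; rewrite inE => /andP[_].
  by rewrite !inE => /andP[].
have [|J [JV disJ VJ]] := greedy_disjoint _ conf.
  by move=> v _; apply/set0Pn; exists v; rewrite inE eqxx.
exists i, S, J; split => //.
- by rewrite -ltnS.
- apply: leq_trans sum_deg; rewrite -sum_nat_const big_mkcond /=.
  by apply: leq_sum => x _; rewrite inE; case: ifP => // /ltnW.
- by move=> v vJ; apply: nbhd_a; apply: subsetP JV v vJ.
- by apply: leq_trans iV _; rewrite leq_mul2l VJ orbT.
Qed.

End Separation.

(** * Numerical estimates *)

Lemma sqrt_nat_le (R : realType) (j : nat) : Num.sqrt j%:R <= j%:R :> R.
Proof.
case: j => [|j]; first by rewrite sqrtr0.
have j1 : 1 <= Num.sqrt j.+1%:R :> R by rewrite -[X in X <= _]sqrtr1 ler_wsqrtr // ler1n.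
rewrite -[leRHS]sqr_sqrtr ?ler0n // expr2.
by rewrite -[leLHS]mul1r ler_wpM2r // sqrtr_ge0.
Qed.

(** With N = n / X rounded down, the powers multiply to at most 2^N 2^N 2^(-4N) = 4^(-N), and 2^N X
    >= (N + 1) X >= n turns this into a bound of order X^2/n^2. *)
Lemma sparse_term_le (R : realType) (n X M s j : nat) (b : R) :
  (0 < n)%N -> (0 < X)%N -> (0 < M)%N -> 0 <= b -> b <= 1 - 1 / M%:R ->
  (s * X <= n)%N -> (4 * M * (n %/ X) <= j)%N ->
  n.+1%:R * (2 ^+ s * (2 ^+ (n %/ X) * b ^+ j)) <= (2 * X ^ 2)%N%:R / Num.sqrt n%:R.
Proof.
move=> n0 X0 M0 b0 bM sX Nj; set N := (n %/ X)%N in Nj *.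
have nR : 0 < n%:R :> R by rewrite ltr0n.
have sN : (s <= N)%N by rewrite leq_divRL.
have jM : (4 * N <= j %/ M)%N by rewrite leq_divRL // mulnAC.
have bj : b ^+ j <= 1 / 2 ^+ (4 * N).
  apply: (@le_trans _ _ ((1 - 1 / M%:R) ^+ j)).
    by rewrite lerXn2r // nnegrE // (le_trans b0).
  apply: le_trans (expr_half_le _ _ M0) _.
  by rewrite !div1r lef_pV2 ?posrE ?exprn_gt0 // ler_weXn2l // ler1n.
have NX : (n <= N.+1 * X)%N by apply: ltnW; rewrite ltn_ceil.
have pow : 2 ^+ s * (2 ^+ N * b ^+ j) <= 1 / (2 ^ N * 2 ^ N)%:R :> R.
  apply: (@le_trans _ _ (2 ^+ N * (2 ^+ N * (1 / 2 ^+ (4 * N))))).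
    rewrite ler_pM ?mulr_ge0 ?exprn_ge0 //; first by rewrite ler_weXn2l // ler1n.
    by rewrite ler_wpM2l // exprn_ge0.
  have T0 : 0 < 2 ^+ N :> R by rewrite exprn_gt0.
  rewrite natrM natrX [(4 * N)%N]mulnC exprM; set T := 2 ^+ N in T0 *.
  by rewrite le_eqVlt; apply/orP; left; apply/eqP; field; rewrite gt_eqF.
have key : (n.+1 * n <= 2 * X ^ 2 * (2 ^ N * 2 ^ N))%N.
  have N2 : (N.+1 <= 2 ^ N)%N by apply: ltn_expl.
  have nT : (n <= 2 ^ N * X)%N by apply: leq_trans NX _; rewrite leq_mul2r N2 orbT.
  have := leq_mul nT nT; rewrite -mulnn; set T := (2 ^ N)%N.
  by move=> ?; nia.
apply: le_trans (ler_wpM2l (ler0n _ _) pow) _.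
rewrite mulrA mulr1 ler_pdivrMr ?ltr0n ?muln_gt0 ?expn_gt0 // mulrAC.
rewrite ler_pdivlMr ?sqrtr_gt0 // -natrM.
apply: (@le_trans _ _ (n.+1%:R * n%:R)); first by rewrite ler_wpM2l ?ler0n // sqrt_nat_le.
by rewrite -natrM ler_nat.
Qed.

(** The choice of [l] gives t >= 2l 2^(d+1), so the second term is at most 2^l 2^(-2l) = 2^(-l),
    which is below the first; and n <= Y (l + 1) bounds the first. *)
Lemma movable_term_le (R : realType) (n X d : nat) (t := (n %/ X)%N)
    (l := (t %/ 2 ^ d.+2)%N) : (0 < n)%N -> (0 < X)%N ->
  1 / Num.sqrt l.+1%:R + 2 ^+ l * (1 - 2^-1 ^+ d / 2) ^+ t <=
  (2 * (X * 2 ^ d.+2))%N%:R / Num.sqrt n%:R :> R.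
Proof.
move=> n0 X0; set Y := (X * 2 ^ d.+2)%N.
have nR : 0 < n%:R :> R by rewrite ltr0n.
have L0 : 0 < l.+1%:R :> R by rewrite ltr0n.
have sL : 0 < Num.sqrt l.+1%:R :> R by rewrite sqrtr_gt0.
have sn : 0 < Num.sqrt n%:R :> R by rewrite sqrtr_gt0.
have base : 1 - 2^-1 ^+ d / 2 = 1 - 1 / (2 ^ d.+1)%:R :> R.
  by rewrite expnS natrM natrX exprVn -invfM mulrC div1r.
have second : 2 ^+ l * (1 - 2^-1 ^+ d / 2) ^+ t <= 1 / Num.sqrt l.+1%:R :> R.
  rewrite base; apply: (@le_trans _ _ (2 ^+ l * (1 / 2 ^+ (l + l)))).
    rewrite ler_wpM2l ?exprn_ge0 //.
    apply: le_trans (expr_half_le _ _ _) _; first by rewrite expn_gt0.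
    rewrite !div1r lef_pV2 ?posrE ?exprn_gt0 // ler_weXn2l ?ler1n //.
    rewrite leq_divRL ?expn_gt0 //; apply: leq_trans (leq_divM t (2 ^ d.+2)).
    by rewrite -/l [(2 ^ d.+2)%N]expnS mulnA muln2 -addnn.
  have -> : 2 ^+ l * (1 / 2 ^+ (l + l)) = 1 / 2 ^+ l :> R.
    have T0 : 0 < 2 ^+ l :> R by rewrite exprn_gt0.
    by rewrite exprD; set T := 2 ^+ l in T0 *; field; rewrite gt_eqF.
  rewrite !div1r lef_pV2 ?posrE ?exprn_gt0 //; apply: le_trans (sqrt_nat_le _ _) _.
  by rewrite -natrX ler_nat ltn_expl.
have first_le : 1 / Num.sqrt l.+1%:R <= Y%:R / Num.sqrt n%:R :> R.
  rewrite ler_pdivrMr // mulrAC ler_pdivlMr // mul1r.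
  have nY : (n <= Y * l.+1)%N.
    rewrite /l /t -divnMA mulnC; apply: ltnW; rewrite ltn_ceil //.
    by rewrite muln_gt0 X0 expn_gt0.
  apply: (@le_trans _ _ (Num.sqrt (Y * l.+1)%:R)).
    by rewrite ler_wsqrtr // ler_nat.
  by rewrite natrM sqrtrM ?ler0n // ler_wpM2r ?sqrt_nat_le // ltW.
rewrite natrM -mulrA mulr_natl mulr2n lerD //.
exact: le_trans second first_le.
Qed.

(** * Towers and the iterated logarithm *)

Lemma leq_tow2 (i j : nat) : (i <= j)%N -> (tow2 i <= tow2 j)%N.
Proof.
move=> ij; rewrite -(subnKC ij); elim: (j - i)%N => [|k IH]; first by rewrite addn0.
by rewrite addnS /=; apply: leq_trans IH _; apply/ltnW/ltn_expl.
Qed.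

Lemma leq_4mul_exp2 (r : nat) : (4 <= r)%N -> (4 * r <= 2 ^ r)%N.
Proof.
elim: r => // r IH; rewrite leq_eqVlt => /orP[/eqP<-//|]; rewrite ltnS => /[dup] r4 /IH.
by rewrite expnS; lia.
Qed.

(** Two further exponentials give X = 2^(2^D), which absorbs everything built from [D] with an
    exponent of at most D^4 <= 2^D. A third one, 2^X, absorbs d X and 4 X^2. *)
Lemma tow2_dominates (e d G : nat) :
  let D := tow2 e in let X := tow2 e.+2 in let a := (d * D).+1 in
  (3 <= e)%N -> (d <= D)%N -> (G <= D)%N ->
  [/\ (4 * (2 * G ^ a) * (d.+1 * (a * a)) <= X)%N, (2 ^ d.+2 <= X)%N,
      (d * X <= 2 ^ X)%N & (4 * X ^ 2 <= 2 ^ X)%N].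
Proof.
move=> D X a e3 dD GD.
have D16 : (16 <= D)%N by apply: (leq_tow2 e3).
have D4 : (D ^ 4 <= 2 ^ D)%N.
  have -> : D = (2 ^ tow2 e.-1)%N by rewrite /D; case: (e) e3.
  rewrite -expnM leq_exp2l // mulnC leq_4mul_exp2 //.
  by apply: (@leq_tow2 2); case: (e) e3.
have DD : (D * D * D * D <= 2 ^ D)%N by move: D4; rewrite !expnS expn0 muln1 !mulnA.
have XE : X = (2 ^ (2 ^ D))%N by [].
have w16 : (4 * 4 <= 2 ^ D)%N by apply: leq_trans DD; nia.
have X2 : (4 * X ^ 2 <= 2 ^ X)%N.
  rewrite {1}XE -expnM -[4%N]/(2 ^ 2)%N -expnD leq_exp2l // XE.
  by have := @leq_4mul_exp2 (2 ^ D); lia.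
have dX : (d <= X)%N by rewrite XE; apply: leq_trans dD _;
  apply: leq_trans (ltnW (ltn_expl _ _)) (ltnW (ltn_expl _ _)).
split=> //.
- have aD : (a <= D * D + 1)%N by rewrite /a; nia.
  have G2 : (G ^ a <= 2 ^ (D * a))%N.
    by rewrite expnM leq_exp2r //; apply: leq_trans GD (ltnW (ltn_expl _ _)).
  have a2 : (a <= 2 ^ a)%N by apply/ltnW/ltn_expl.
  have d2 : (d.+1 <= 2 ^ d)%N by apply: ltn_expl.
  apply: (@leq_trans (2 ^ (3 + D * a + (d + (a + a))))%N).
    by rewrite !expnD; apply: leq_mul; [rewrite mulnA leq_mul2l G2 orbT|rewrite !leq_mul].
  rewrite XE leq_exp2l //; apply: leq_trans DD.
  by clear -aD dD D16; nia.
- rewrite XE leq_exp2l //; have := leq_4mul_exp2 (leq_trans (isT : (4 <= 16)%N) D16);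
  move: dD D16; set E2 := (2 ^ D)%N; lia.
- apply: leq_trans X2; rewrite -mulnn; apply: leq_trans (leq_pmull _ (isT : (0 < 4)%N)).
  by rewrite leq_mul2r dX orbT.
Qed.

Lemma logstarP (R : realType) (x : R) : x <= (tow2 (logstar x))%:R.
Proof. by rewrite /logstar; case: ex_minnP. Qed.

Lemma tow2_lt_of_logstar (R : realType) (x : R) (j : nat) :
  (j < logstar x)%N -> (tow2 j)%:R < x.
Proof.
rewrite /logstar; case: ex_minnP => h _ hmin jh; rewrite ltNge.
by apply/negP => /hmin; rewrite leqNgt jh.
Qed.

Theorem mainTheorem7 :
  exists kappa : nat, (1 <= kappa)%N /\
  forall (R : realType) (n k m d : nat)
    (f : {ffun 'I_m -> bool} -> {ffun 'I_n -> bool}) (theta : R),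
    (2 <= n)%N -> (1 <= k)%N -> (k.*2 <= n)%N ->
    local d f -> 0 < theta ->
    kappa%:R <= theta ->
    d%:R <= (logstar theta)%:R / 60 :> R ->
    (logstar (n%:R / k%:R : R))%:R <= (logstar theta)%:R / 2 :> R ->
    1 - theta / Num.sqrt n%:R <= tvd (@push_unif R m n f) (@Dk R n k).
Proof.
(* [h0] is made abstract so that [tow2 9] is never evaluated. *)
have [h0 h0_ge9] : exists h0 : nat, (9 <= h0)%N by exists 9%N.
exists (tow2 h0).+1; split=> [//|].
move=> R n k m d f theta n2 k1 k2 floc theta0 kappa_le d_le gamma_le.
have n0 : (0 < n)%N by apply: leq_trans n2.
have nR : 0 < n%:R :> R by rewrite ltr0n.
have kR : 0 < k%:R :> R by rewrite ltr0n.
set h := logstar theta in d_le gamma_le.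
have h9 : (9 <= h)%N.
  rewrite leqNgt; apply/negP => h8; have := le_trans kappa_le (logstarP theta).
  by rewrite -/h ler_nat leqNgt ltnS leq_tow2 // ltnW // (leq_trans h8).
have dh : (60 * d <= h)%N by rewrite -(ler_nat R) natrM; lra.
set L := logstar _ in gamma_le.
have Lh : (2 * L <= h)%N by rewrite -(ler_nat R) natrM; lra.
(* The hypothesis on [k] gives [L <= g], so n/k is at most [tow2 g]. *)
pose g := h./2.
have nG : (n <= tow2 g * k)%N.
  rewrite -(ler_nat R) natrM -ler_pdivrMr //; apply: le_trans (logstarP _) _.
  by rewrite ler_nat leq_tow2 // -/L /g; lia.
have [N NP] : exists N : 'I_n -> {set 'I_m},
    forall u, (#|N u| <= d)%N /\ depends_on (N u) (fun x => f x u).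
  by apply: (fin_all_exists (P := fun u (S : {set 'I_m}) =>
    (#|S| <= d)%N /\ depends_on S (fun x => f x u))) => u; apply: floc.
(* Thresholds are three tower levels apart: with [tau i] at height [e], [X] sits at height e + 2 and
   the next threshold is 2^X. *)
pose tau i := tow2 (g + 3 * i).
have tau_mono i j : (i <= j)%N -> (tau i <= tau j)%N.
  by move=> ij; apply: leq_tow2; lia.
have [i [S [J]]] := separated_outputs (fun u => (NP u).1) tau_mono.
set B := fun v => N v :\: S; set a := (d * tau i).+1.
move=> [id sizeS disJ nbhd_a sizeJ].
pose e := (g + 3 * i)%N; pose X := tow2 e.+2.
have e3 : (3 <= e)%N by rewrite /e /g; lia.
have de : (d <= tow2 e)%N by apply: leq_trans (tow2_ge e); rewrite /e /g; lia.
have Ge : (tow2 g <= tow2 e)%N by apply: leq_tow2; rewrite /e; lia.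
have [bigX dX dXX X2] := tow2_dominates e3 de Ge.
rewrite -/X -[(d * tow2 e).+1]/a in bigX dX dXX X2.
have tauS : tau i.+1 = (2 ^ X)%N by rewrite /tau mulnS addnCA add3n.
have X0 : (0 < X)%N by apply: leq_trans dX; rewrite expn_gt0.
(* As g <= h/2 and 3i <= 3d <= h/20, the height e + 3 is at most h - 1 once h >= 9, and [theta]
   exceeds the tower of height h - 1. *)
have X2_theta : (4 * X ^ 2)%:R <= theta.
  apply: (@le_trans _ _ (tow2 e.+3)%:R); first by rewrite ler_nat.
  apply: le_trans (ltW (@tow2_lt_of_logstar R theta h.-1 _)); last by rewrite -/h; lia.
  by rewrite ler_nat leq_tow2 // /e /g; lia.
pose p : R := k%:R / n%:R.
have p0 : 0 < p by apply: divr_gt0.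
have p_half : p <= 2^-1.
  by rewrite /p ler_pdivrMr // ler_pdivlMl // -natrM ler_nat mul2n.
have p_low : 1 / (tow2 g)%:R <= p.
  have G0 : 0 < (tow2 g)%:R :> R by rewrite ltr0n (leq_trans _ (leq_tow2 (leq0n g))).
  by rewrite /p ler_pdivlMr // mulrAC ler_pdivrMr // mul1r -natrM ler_nat mulnC.
(* The bound on [S] is divided by [d] using d X <= 2^X; for d = 0 it forces [S] to be empty. *)
have sX : (#|S| * X <= n)%N.
  case: (posnP d) => [d0|d_gt0].
    by move: sizeS; rewrite d0 muln0 tauS leqn0 muln_eq0 expn_eq0 orbF => /eqP->.
  rewrite -(leq_pmul2r d_gt0) -mulnA [(X * d)%N]mulnC.
  by apply: leq_trans sizeS; rewrite tauS leq_mul2l dXX orbT.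
have jX : (4 * (2 * tow2 g ^ a) * (n %/ X) <= #|J|)%N.
  rewrite -(leq_pmul2r (_ : 0 < d.+1 * (a * a))%N) // mulnAC.
  apply: leq_trans (_ : X * (n %/ X) <= _)%N; first by rewrite leq_mul2r bigX orbT.
  rewrite mulnC; apply: leq_trans (leq_divM n X) _.
  by apply: leq_trans sizeJ _; rewrite mulnCA.
have M0 : (0 < 2 * tow2 g ^ a)%N.
  by rewrite muln_gt0 expn_gt0 (leq_trans _ (leq_tow2 (leq0n g))).
have b0 : 0 <= 1 - p ^+ a / 2.
  have : p ^+ a <= 1 by rewrite exprn_ile1 //; lra.
  by lra.
(* The bound p >= 1 / [tow2 g] is where the density k/n enters; it provides the [M] of
   [sparse_term_le]. *)
have bM : 1 - p ^+ a / 2 <= 1 - 1 / (2 * tow2 g ^ a)%N%:R.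
  rewrite lerD2l lerN2 natrM natrX mul1r invfM mulrC ler_wpM2r ?invr_ge0 //.
  by rewrite -exprVn lerXn2r ?nnegrE ?invr_ge0 ?ler0n ?(ltW p0) // -div1r.
have Bd v : (#|B v| <= d)%N by apply: leq_trans (NP v).1; rewrite subset_leq_card ?subsetDl.
have BN v : B v \subset N v by apply: subsetDl.
have NBS v : v \in J -> N v \subset B v :|: S.
  by move=> _; apply/subsetP => x xN; rewrite !inE xN andbT orNb.
have kn : (k <= n)%N by rewrite (leq_trans _ k2) // -addnn leq_addr.
apply: le_trans (@tvd_lower_bound R m n d f N B J (fun u => (NP u).2) Bd disJ BN
  S NBS a p p0 p_half isT nbhd_a k (n %/ X) (n %/ X %/ 2 ^ d.+2) n0 kn erefl).
have q1 := sparse_term_le n0 X0 M0 b0 bM sX jX.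
have q2 := @movable_term_le R n X d n0 X0.
(* Since 2^(d+2) <= X, each error term is at most 2 X^2 / sqrt n, whence the total 4 X^2 <=
   [theta]. *)
rewrite -addrA lerD2l -opprD lerN2; apply: le_trans (lerD q1 q2) _.
rewrite -mulrDl ler_wpM2r ?invr_ge0 ?sqrtr_ge0 //; apply: le_trans X2_theta.
by rewrite -natrD ler_nat -mulnn -[4%N]/(2 + 2)%N mulnDl leq_add2l !leq_mul2l dX !orbT.
Qed.
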